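(* For every signed graph $(G,\sigma)$ it holds that $\chi_{sym}(G,\sigma) \leq \chi(G)$. Furthermore, if $(G,\sigma)$ and $(G,\sigma')$ are equivalent signed graphs, then $\chi_{sym}(G,\sigma) = \chi_{sym}(G,\sigma')$. In particular, if $(G,\sigma)$ is equivalent to $(G,\mathbf{+})$, then $\chi_{sym}(G,\sigma) = \chi(G)$.
   Context: Graphs are finite multigraphs without loops (parallel edges allowed); $\chi(G)$ is the ordinary chromatic number of $G$. A signed graph $(G,\sigma)$ is a graph $G$ with a signature $\sigma:E(G)\to\{+,-\}$; $\mathbf{+}$ is the all-positive signature. Switching at $X\subseteq V(G)$ reverses the sign of every edge with exactly one end in $X$; $(G,\sigma)$ and $(G,\sigma')$ are equivalent if one is obtained from the other by switching at some vertex set. A symmetric set is a set $S$ with an involution $s\mapsto -s$ on $S$; $s$ is self-inverse if $s=-s$. $S_{2k}^t$ ($t,k\ge 0$) is the symmetric set with exactly $t$ self-inverse elements $0_1,\dots,0_t$ and $2k$ non-self-inverse elements $\pm s_1,\dots,\pm s_k$. A proper $S_{2k}^t$-coloring of $(G,\sigma)$ is a map $c:V(G)\to S_{2k}^t$ with $c(v)\ne\sigma(e)c(w)$ for every edge $e=vw$. For $t\in\{0,\dots,\chi(G)\}$, $\chi_{sym}^t(G,\sigma)$ is the minimum of $t+2k$ over all $k\ge0$ for which $(G,\sigma)$ has a proper $S_{2k}^t$-coloring. The symset chromatic number is $\chi_{sym}(G,\sigma)=\min\{\chi_{sym}^t(G,\sigma): 0\le t\le\chi(G)\}$ (where, when a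 particular $t$ has to be singled out, the maximum $t$ attaining the minimum is taken). *)

(* Defs.v *)
From mathcomp Require Import all_boot.

Set Implicit Arguments.
Unset Strict Implicit.
Unset Printing Implicit Defensive.

(* Two distinct edges may have the same set of ends (parallel edges), and the
   cardinality condition rules out loops. *)
Record multigraph := Multigraph {
  vertex : finType;
  edge : finType;
  ends : edge -> {set vertex};
  card_ends : forall e, #|ends e| = 2
}.

Definition proper_coloring (G : multigraph) (C : finType)
    (c : {ffun vertex G -> C}) : Prop :=
  forall (e : edge G) (v w : vertex G), ends e = [set v; w] -> c v <> c w.

Definition proper_coloringb (G : multigraph) (C : finType)
    (c : {ffun vertex G -> C}) : bool :=
  [forall e, forall v, forall w, (ends e == [set v; w]) ==> (c v != c w)].

Lemma proper_coloringP (G : multigraph) (C : finType)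
    (c : {ffun vertex G -> C}) :
  reflect (proper_coloring c) (proper_coloringb c).
Proof.
apply: (iffP forallP) => [H e v w Evw|H e].
  by move: H => /(_ e)/forallP/(_ v)/forallP/(_ w)/implyP/(_ (introT eqP Evw))/eqP.
apply/forallP=> v; apply/forallP=> w; apply/implyP=> /eqP Evw.
exact/eqP/(H e).
Qed.

Definition colorable (G : multigraph) (n : nat) : bool :=
  [exists c : {ffun vertex G -> 'I_n}, proper_coloringb c].

Lemma ends_neq (G : multigraph) (e : edge G) (v w : vertex G) :
  ends e = [set v; w] -> v <> w.
Proof. by move=> Evw vw; have := card_ends e; rewrite Evw vw cards2 eqxx. Qed.

Lemma ex_colorable (G : multigraph) : exists n, colorable G n.
Proof.
exists #|vertex G|; apply/existsP; exists [ffun v => enum_rank v].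
by apply/proper_coloringP=> e v w /ends_neq vw; rewrite !ffunE => /enum_rank_inj.
Qed.

Definition chi (G : multigraph) : nat := ex_minn (ex_colorable G).

(* A sign is a boolean, with false for + and true for -, so that addb is the
   product of signs. *)
Definition signature (G : multigraph) := {ffun edge G -> bool}.

Definition all_positive (G : multigraph) : signature G := [ffun=> false].

Definition switch (G : multigraph) (X : {set vertex G}) (sigma : signature G) :
    signature G :=
  [ffun e => sigma e (+) (#|ends e :&: X| == 1)].

Definition equivalent (G : multigraph) (sigma sigma' : signature G) : Prop :=
  exists X : {set vertex G}, sigma' = switch X sigma.

Lemma switchK (G : multigraph) (X : {set vertex G}) : involutive (switch X).
Proof. by move=> sigma; apply/ffunP=> e; rewrite !ffunE addbK. Qed.

Lemma equivalent_sym (G : multigraph) (sigma sigma' : signature G) :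
  equivalent sigma sigma' <-> equivalent sigma' sigma.
Proof. by split=> -[X ->]; exists X; rewrite switchK. Qed.

Record symset := Symset {
  symset_elt :> finType;
  sopp : symset_elt -> symset_elt;
  soppK : involutive sopp
}.

Definition self_inverse (S : symset) (s : S) : bool := s == sopp s.

Definition sign_act (S : symset) (b : bool) (s : S) : S :=
  if b then sopp s else s.

(* inl i is the self-inverse element 0_i, inr (j, false) is s_j and
   inr (j, true) is - s_j. *)
Definition Sopp (t k : nat) (s : 'I_t + 'I_k * bool) : 'I_t + 'I_k * bool :=
  match s with
  | inl i => inl i
  | inr (j, b) => inr (j, ~~ b)
  end.

Lemma SoppK (t k : nat) : involutive (@Sopp t k).
Proof. by case=> [//|[j b]] /=; rewrite negbK. Qed.

Definition Sset (t k : nat) : symset :=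
  @Symset ('I_t + 'I_k * bool)%type (@Sopp t k) (@SoppK t k).

Lemma card_self_inverse (t k : nat) : #|[set s : Sset t k | self_inverse s]| = t.
Proof.
rewrite -[RHS]card_ord -(card_imset _ (@inl_inj 'I_t ('I_k * bool)%type)).
apply: eq_card => -[i|[j b]]; rewrite !inE /self_inverse /=.
  by rewrite eqxx imset_f.
by apply/idP/imsetP => [/eqP[]|[x _ //]]; case: b.
Qed.

Lemma card_Sset (t k : nat) : #|Sset t k| = t + k.*2.
Proof. by rewrite card_sum card_prod card_bool !card_ord muln2. Qed.

Definition sym_coloring (G : multigraph) (sigma : signature G) (S : symset)
    (c : {ffun vertex G -> S}) : Prop :=
  forall (e : edge G) (v w : vertex G),
    ends e = [set v; w] -> c v <> sign_act (sigma e) (c w).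

Definition sym_coloringb (G : multigraph) (sigma : signature G) (S : symset)
    (c : {ffun vertex G -> S}) : bool :=
  [forall e, forall v, forall w,
    (ends e == [set v; w]) ==> (c v != sign_act (sigma e) (c w))].

Lemma sym_coloringP (G : multigraph) (sigma : signature G) (S : symset)
    (c : {ffun vertex G -> S}) :
  reflect (sym_coloring sigma c) (sym_coloringb sigma c).
Proof.
apply: (iffP forallP) => [H e v w Evw|H e].
  by move: H => /(_ e)/forallP/(_ v)/forallP/(_ w)/implyP/(_ (introT eqP Evw))/eqP.
apply/forallP=> v; apply/forallP=> w; apply/implyP=> /eqP Evw.
exact/eqP/(H e).
Qed.

Definition sym_colorable (G : multigraph) (sigma : signature G) (t k : nat) :
    bool :=
  [exists c : {ffun vertex G -> Sset t k}, sym_coloringb sigma c].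

(* The bound k <= m is implied by m = t + 2k. *)
Definition sym_value (G : multigraph) (sigma : signature G) (t m : nat) : bool :=
  [exists k : 'I_m.+1, (m == t + k.*2) && sym_colorable sigma t k].

Lemma sym_valueP (G : multigraph) (sigma : signature G) (t m : nat) :
  reflect (exists2 k, m = t + k.*2 & sym_colorable sigma t k)
          (sym_value sigma t m).
Proof.
apply: (iffP existsP) => [[k /andP[/eqP mE ck]]|[k mE ck]]; first by exists k.
have lekm : k < m.+1.
  by rewrite ltnS mE -addnn (leq_trans (leq_addr k k)) // leq_addl.
by exists (Ordinal lekm); apply/andP; split=> //; apply/eqP.
Qed.

Lemma ex_sym_value (G : multigraph) (sigma : signature G) (t : nat) :
  exists m, sym_value sigma t m.
Proof.
exists (t + #|vertex G|.*2); apply/sym_valueP; exists #|vertex G| => //.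
apply/existsP; exists [ffun v => inr (enum_rank v, false)].
apply/sym_coloringP=> e v w /ends_neq vw; rewrite !ffunE /sign_act.
by case: ifP => _ [] // /enum_rank_inj.
Qed.

Definition chi_sym_at (G : multigraph) (sigma : signature G) (t : nat) : nat :=
  ex_minn (ex_sym_value sigma t).

Definition chi_sym (G : multigraph) (sigma : signature G) : nat :=
  chi_sym_at sigma
    [arg min_(t < (ord0 : 'I_(chi G).+1)) chi_sym_at sigma t].

(* Main.v *)
Require Import Defs.
From mathcomp Require Import all_boot.

(** Self-inverse colors impose the same constraint on an edge whatever its sign,
so a proper coloring with [chi G] colors is a symmetric coloring with
[t = chi G] and [k = 0].  Switching at [X] is undone by negating the colors on
[X].  For the all-positive signature a symmetric coloring is just a proper
coloring by [t + 2 k] colors. *)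

Set Implicit Arguments.
Unset Strict Implicit.
Unset Printing Implicit Defensive.

Lemma chi_le (G : multigraph) (n : nat) : colorable G n -> chi G <= n.
Proof. by rewrite /chi; case: ex_minnP => m _; apply. Qed.

Lemma colorable_chi (G : multigraph) : colorable G (chi G).
Proof. by rewrite /chi; case: ex_minnP. Qed.

Lemma proper_coloring_colorable (G : multigraph) (C : finType)
    (c : {ffun vertex G -> C}) : proper_coloring c -> colorable G #|C|.
Proof.
move=> cP; apply/existsP; exists [ffun v => enum_rank (c v)].
by apply/proper_coloringP => e v w /cP cvw; rewrite !ffunE => /enum_rank_inj.
Qed.

Lemma chi_sym_le (G : multigraph) (sigma : signature G) (t k : nat) :
  t <= chi G -> sym_colorable sigma t k -> chi_sym sigma <= t + k.*2.
Proof.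
move=> let_chi ck; rewrite /chi_sym; case: arg_minnP => //= i _.
move=> /(_ (Ordinal (let_chi : t < (chi G).+1)) isT) /leq_trans; apply.
rewrite /= /chi_sym_at; case: ex_minnP => m _; apply.
by apply/sym_valueP; exists k.
Qed.

(** With [chi_sym_le], this characterizes [chi_sym] as a minimum over pairs [t], [k], so that the
    nested minima need not be unfolded again. *)
Lemma chi_sym_attained (G : multigraph) (sigma : signature G) :
  exists t k, [/\ t <= chi G, sym_colorable sigma t k
                & chi_sym sigma = t + k.*2].
Proof.
rewrite /chi_sym; set i := arg_min _ _ _; exists i; rewrite /chi_sym_at.
case: ex_minnP => _ /sym_valueP[k -> ck] _; exists k; split=> //.
by rewrite -ltnS ltn_ord.
Qed.

Lemma colorable_sym_colorable (G : multigraph) (sigma : signature G) (n : nat) :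
  colorable G n -> sym_colorable sigma n 0.
Proof.
case/existsP=> c /proper_coloringP cP; apply/existsP.
exists [ffun v => inl (c v)]; apply/sym_coloringP=> e v w /cP cvw.
by rewrite !ffunE /sign_act; case: ifP => _ [].
Qed.

Lemma sign_act_addb (S : symset) (b b' : bool) (s : S) :
  sign_act (b (+) b') s = sign_act b (sign_act b' s).
Proof. by case: b b' => [] [] //=; rewrite soppK. Qed.

Lemma sign_act_inj (S : symset) (b : bool) : injective (@sign_act S b).
Proof. by case: b => // s s' /(inv_inj (@soppK S)). Qed.

(** As [v] and [w] are distinct, the cardinality is a sum of two indicators, which is 1 exactly when
    they differ. In this form the sign change made by [switch] splits into one factor per end of the
    edge. *)
Lemma cards2I_eq1 (T : finType) (v w : T) (X : {set T}) :
  v != w -> (#|[set v; w] :&: X| == 1) = (v \in X) (+) (w \in X).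
Proof.
move=> vw; rewrite setIUl cardsU -setIIl (_ : [set v] :&: [set w] = set0).
  have card1I x : #|[set x] :&: X| = (x \in X).
    case: (boolP (x \in X)) => xX.
      by rewrite (setIidPl _) ?cards1 ?sub1set.
    by apply/eqP; rewrite cards_eq0 setI_eq0 disjoints1.
  by rewrite set0I cards0 subn0 !card1I; case: (v \in X) (w \in X) => [] [].
by apply/eqP; rewrite setI_eq0 disjoints1 inE.
Qed.

Lemma sym_colorable_switch (G : multigraph) (sigma : signature G)
    (X : {set vertex G}) (t k : nat) :
  sym_colorable sigma t k -> sym_colorable (switch X sigma) t k.
Proof.
case/existsP=> c /sym_coloringP cP; apply/existsP.
exists [ffun v => sign_act (v \in X) (c v)]; apply/sym_coloringP=> e v w Evw.
rewrite !ffunE Evw cards2I_eq1; last exact/eqP/(ends_neq Evw).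
(* The factor of [w] cancels against the negation of [c w]. The factor of [v] moves to the front and
   cancels against that of [c v], leaving the constraint of [c] under [sigma]. *)
rewrite -sign_act_addb addbA addbK addbC sign_act_addb => /sign_act_inj.
exact: cP Evw.
Qed.

Lemma chi_sym_switch_le (G : multigraph) (sigma : signature G)
    (X : {set vertex G}) : chi_sym (switch X sigma) <= chi_sym sigma.
Proof.
have [t [k [let_chi ck ->]]] := chi_sym_attained sigma.
exact/chi_sym_le/sym_colorable_switch.
Qed.

Lemma chi_sym_equivalent (G : multigraph) (sigma sigma' : signature G) :
  equivalent sigma sigma' -> chi_sym sigma = chi_sym sigma'.
Proof.
case=> X ->; apply/anti_leq/andP; split; last exact: chi_sym_switch_le.
(* Switching at [X] a second time restores [sigma], so the same inequality gives the converse
   one. *)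
by have := chi_sym_switch_le (switch X sigma) X; rewrite switchK.
Qed.

Lemma chi_sym_le_chi (G : multigraph) (sigma : signature G) :
  chi_sym sigma <= chi G.
Proof.
(* The added 0 is [k.*2] for [k = 0]. *)
rewrite -[leqRHS]addn0; apply: (@chi_sym_le _ _ _ 0) => //.
exact/colorable_sym_colorable/colorable_chi.
Qed.

Lemma chi_sym_all_positive (G : multigraph) : chi_sym (all_positive G) = chi G.
Proof.
apply/eqP; rewrite eqn_leq chi_sym_le_chi /=.
have [t [k [_ /existsP[c /sym_coloringP cP] ->]]] :=
  chi_sym_attained (all_positive G).
(* All of [Sset t k] serves as an ordinary palette. *)
rewrite -card_Sset; apply/chi_le/(@proper_coloring_colorable _ _ c).
by move=> e v w /cP; rewrite ffunE.
Qed.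

Theorem proposition1p5 (G : multigraph) :
  [/\ forall sigma : signature G, chi_sym sigma <= chi G,
      forall sigma sigma' : signature G,
        equivalent sigma sigma' -> chi_sym sigma = chi_sym sigma'
    & forall sigma : signature G,
        equivalent sigma (all_positive G) -> chi_sym sigma = chi G].
Proof.
split=> [sigma|sigma sigma'|sigma]; first exact: chi_sym_le_chi.
  exact: chi_sym_equivalent.
by move/chi_sym_equivalent->; exact: chi_sym_all_positive.
Qed.
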